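(* Let $(x(t))_{t\ge 0}$ be a trajectory of the mixed Hegselmann-Krause model with $n$ agents, opinions in $\mathbf{R}^d$, confidence bound $\epsilon>0$ and stubbornness degrees $\alpha_i(t)\in[0,1]$. Let $i\in[n]$ and define $d_t^i=\max_{j\in N_i(t)}\|x_i(t)-x_j(t)\|$. If $$\sum_{t=0}^{\infty}(1-\alpha_i(t))\left(1-\frac{1}{|N_i(t)|}\right)d_t^i<\infty,$$ then there is $x_i\in\mathbf{R}^d$ such that $x_i(t)\to x_i$ as $t\to\infty$.
   Context: Notation: $[n]=\{1,\dots,n\}$ with $n\ge 1$, $\mathbf{N}=\{0,1,2,\dots\}$, $\|\cdot\|$ is the Euclidean norm on $\mathbf{R}^d$. Mixed Hegselmann-Krause model: given $\epsilon>0$, arbitrary initial opinions $x_1(0),\dots,x_n(0)\in\mathbf{R}^d$ and given numbers $\alpha_i(t)\in[0,1]$ ($i\in[n]$, $t\in\mathbf{N}$), the opinions evolve by $$x_i(t+1)=\alpha_i(t)\,x_i(t)+\frac{1-\alpha_i(t)}{|N_i(t)|}\sum_{j\in N_i(t)}x_j(t),\qquad N_i(t)=\{j\in[n]:\|x_i(t)-x_j(t)\|\le\epsilon\}$$ (so $i\in N_i(t)$). *)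

(* Defs.v *)
From mathcomp Require Import all_boot all_order all_algebra.
From mathcomp Require Import all_classical all_reals all_analysis.
Set Implicit Arguments.
Unset Strict Implicit.
Unset Printing Implicit Defensive.
Import Order.TTheory GRing.Theory Num.Theory.
Import numFieldNormedType.Exports.
Local Open Scope ring_scope.

(* The library norm `|v| on row vectors is the sup norm, hence an explicit
   Euclidean norm. Both induce the library's topology on 'rV[R]_d. *)
Definition enorm (R : realType) (d : nat) (v : 'rV[R]_d) : R :=
  Num.sqrt (\sum_(k < d) v 0 k ^+ 2).

(* An opinion profile is a function p : 'I_n -> 'rV[R]_d; agents are numbered
   from 0. *)
Definition neighbors (R : realType) (n d : nat) (eps : R)
    (p : 'I_n -> 'rV[R]_d) (i : 'I_n) : {set 'I_n} :=
  [set j : 'I_n | enorm (p i - p j) <= eps]%SET.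

Definition mixed_HK (R : realType) (n d : nat) (eps : R)
    (alpha : nat -> 'I_n -> R) (x : nat -> 'I_n -> 'rV[R]_d) : Prop :=
  forall (t : nat) (i : 'I_n),
    x t.+1 i = alpha t i *: x t i +
      ((1 - alpha t i) / #|neighbors eps (x t) i|%:R) *:
        \sum_(j in neighbors eps (x t) i) x t j.

(* The default value 0 is harmless: for eps >= 0, agent i is among its own
   neighbors and contributes enorm 0 = 0. *)
Definition neighbor_dist (R : realType) (n d : nat) (eps : R)
    (p : 'I_n -> 'rV[R]_d) (i : 'I_n) : R :=
  \big[Num.max/0]_(j in neighbors eps p i) enorm (p i - p j).

(* Main.v *)
Require Import Defs.
From HB Require Import structures.
From mathcomp Require Import all_boot all_order all_algebra.
From mathcomp Require Import all_classical all_reals all_analysis.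
Import Order.TTheory GRing.Theory Num.Theory.
Import numFieldNormedType.Exports.
Local Open Scope classical_set_scope.
Local Open Scope ring_scope.

(** The summand of the hypothesis bounds the displacement of agent [i] at
    time [t].  Indeed, one update adds to [x t i] the vector
    (1 - alpha) / |N| times the sum of the differences [x t j - x t i] over
    the neighbors [j].  The term [j = i] vanishes, and each of the other
    |N| - 1 terms is at most the largest neighbor distance; this is where the
    factor (|N| - 1) / |N| = 1 - 1 / |N| comes from
    ([norm_mixed_HK_step_le]).  The trajectory of the agent thus has finite
    length, and in a complete space such a sequence converges
    ([cvgn_summable_steps]).

    Convergence is proved for the sup norm of row vectors.  It is dominated by
    the Euclidean norm ([norm_le_enorm]), so a bound on Euclidean distances
    suffices. *)

(** Matrices over the reals are complete and normed; this joins the two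
    structures. *)
HB.instance Definition _ (R : realType) (m n : nat) :=
  NormedModule.on 'M[R]_(m, n).

Lemma cvgn_summable_steps (R : realType) (V : completeNormedModType R)
    (u : nat -> V) (b : nat -> R) :
  (forall t, `|u t.+1 - u t| <= b t) -> cvgn (series b) -> cvgn u.
Proof.
move=> ub cb.
have cu : cvgn (series (telescope u)).
  apply: normed_cvg; apply: (series_le_cvg _ _ ub cb) => t //.
  exact: le_trans (ub t).
have -> : u = (fun t => u 0%N + series (telescope u) t).
  by apply/funext => t; exact: eq_sum_telescope.
by apply: is_cvgD => //; exact: is_cvg_cst.
Qed.

Lemma norm_le_enorm (R : realType) (d : nat) (v : 'rV[R]_d) :
  `|v| <= enorm v.
Proof.
rewrite /Num.norm/= mx_normrE; apply: bigmax_le => [|[i j] _].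
  exact: sqrtr_ge0.
rewrite ord1 -sqrtr_sqr /enorm ler_wsqrtr// (bigD1 j)//= lerDl.
by apply: sumr_ge0 => k _; exact: sqr_ge0.
Qed.

Section Neighborhood.
Variables (R : realType) (n d : nat) (eps : R) (p : 'I_n -> 'rV[R]_d).
Variable i : 'I_n.
Local Notation N := (neighbors eps p i).

Lemma mem_neighbors : 0 <= eps -> i \in N.
Proof.
move=> eps0; rewrite inE subrr /enorm big1 ?sqrtr0// => k _.
by rewrite mxE expr0n.
Qed.

Lemma neighbor_dist_ge0 : 0 <= neighbor_dist eps p i.
Proof. exact: bigmax_ge_id. Qed.

Lemma norm_sum_neighbors_le : i \in N ->
  `|\sum_(j in N) (p j - p i)| <= #|N|.-1%:R * neighbor_dist eps p i.
Proof.
move=> iN; rewrite (big_setD1 i)//= subrr add0r (le_trans (ler_norm_sum _ _ _))//.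
have -> : #|N|.-1 = #|(N :\ i)%SET| by rewrite (cardsD1 i) iN.
rewrite mulr_natl -sumr_const; apply: ler_sum => j.
rewrite inE => /andP[_ jN]; rewrite distrC (le_trans (norm_le_enorm _ _ _))//.
exact: (le_bigmax_cond 0 (fun j => enorm (p i - p j))).
Qed.

End Neighborhood.

Lemma norm_mixed_HK_step_le (R : realType) (n d : nat) (eps : R)
    (alpha : nat -> 'I_n -> R) (x : nat -> 'I_n -> 'rV[R]_d)
    (t : nat) (i : 'I_n) :
  0 <= eps -> alpha t i <= 1 -> mixed_HK eps alpha x ->
  `|x t.+1 i - x t i| <=
    (1 - alpha t i) * (1 - #|neighbors eps (x t) i|%:R^-1)
      * neighbor_dist eps (x t) i.
Proof.
move=> eps0 a1 hx.
have iN := mem_neighbors _ _ _ _ (x t) i eps0.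
have leS := norm_sum_neighbors_le _ _ _ _ _ _ iN.
rewrite hx; set N := neighbors _ _ _ in iN leS *.
have N0 : (0 < #|N|)%N by rewrite (cardD1 i) iN.
have Nn0 : #|N|%:R != 0 :> R by rewrite pnatr_eq0 -lt0n.
have -> : alpha t i *: x t i + ((1 - alpha t i) / #|N|%:R) *: \sum_(j in N) x t j
          - x t i
        = ((1 - alpha t i) / #|N|%:R) *: \sum_(j in N) (x t j - x t i).
  rewrite sumrB sumr_const -[x t i *+ _]scaler_nat scalerBr scalerA divfK//.
  by rewrite scalerBl scale1r opprB addrAC addrC.
have c0 : 0 <= (1 - alpha t i) / #|N|%:R by rewrite divr_ge0// subr_ge0.
rewrite normrZ ger0_norm// (le_trans (ler_wpM2l c0 leS))//.
rewrite mulrA ler_wpM2r ?neighbor_dist_ge0// -mulrA ler_wpM2l ?subr_ge0//.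
by rewrite -subn1 natrB// mulrBr mulVf// mulr1.
Qed.

Theorem theorem2 (R : realType) (n d : nat) (eps : R)
    (alpha : nat -> 'I_n -> R) (x : nat -> 'I_n -> 'rV[R]_d)
    (heps : 0 < eps)
    (halpha : forall (t : nat) (j : 'I_n), 0 <= alpha t j <= 1)
    (hx : mixed_HK eps alpha x)
    (i : 'I_n)
    (hsum : (\sum_(0 <= t <oo)
               ((1 - alpha t i) * (1 - #|neighbors eps (x t) i|%:R^-1)
                 * neighbor_dist eps (x t) i)%:E < +oo)%E) :
  exists xi : 'rV[R]_d, x t i @[t --> \oo] --> xi.
Proof.
have a1 t : alpha t i <= 1 by case/andP: (halpha t i).
have step t := norm_mixed_HK_step_le _ _ _ _ _ _ t i (ltW heps) (a1 t) hx.
have b0 t := le_trans (normr_ge0 _) (step t).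
have /cvg_ex[xi xi_lim] :=
  cvgn_summable_steps _ _ (fun t => x t i) _ step (nnseries_is_cvg b0 hsum).
by exists xi.
Qed.
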